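(* Let $\overline G^{(n)}$ be an oasitic cover of an almost simple simply-connected group $G$ with $Q(\alpha^\vee)=1$ for every short coroot $\alpha^\vee$. Then every $W$-orbit $\mathcal O\subset\mathscr X_{Q,n}$ is splitting.
   Context: $G$ is a split almost simple simply-connected group with simple roots $\Delta$, cocharacter lattice $Y$ (equal to the coroot lattice), and Weyl group $W$. $Q:Y\to\mathbb Z$ is the $W$-invariant quadratic form with $Q(\alpha^\vee)=1$ for short coroots (all coroots are short in the simply-laced case), $B_Q(y,z)=Q(y+z)-Q(y)-Q(z)$, and $\overline G^{(n)}$ is the $n$-fold (Brylinski--Deligne) cover of $G$ attached to $Q$ and $n\ge1$; only $Q$ and $n$ matter here. $\det(B_Q)$ is the determinant of the Gram matrix of $B_Q$ in a $\mathbb Z$-basis of $Y$. Write the highest coroot as $\alpha_\sharp^\vee=\sum_{\alpha\in\Delta}c_\alpha^\sharp\alpha^\vee$. The cover is *oasitic* if $\gcd(n,c_\alpha^\sharp)=1=\gcd(n,\det(B_Q))$ for every $\alpha\in\Delta$. $Y_{Q,n}=\{y\in Y:B_Q(y,z)\in n\mathbb Z\ \forall z\in Y\}$, $\mathscr X_{Q,n}=Y/Y_{Q,n}$, with the induced $W$-action. A $W$-orbit $\mathcal O\subset\mathscr X_{Q,n}$ is *splitting* if there is a $W$-equivariant map $s:\mathcal O\to Y$ whose composition with $Y\to\mathscr X_{Q,n}$ is the inclusion of $\mathcal O$. *)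

(* Defs.v *)
From HB Require Import structures.
From mathcomp Require Import all_boot all_order all_algebra.
From mathcomp Require Import generic_quotient ring_quotient.
From mathcomp Require Import boolp classical_sets.
Set Implicit Arguments.
Unset Strict Implicit.
Unset Printing Implicit Defensive.
Import Order.TTheory GRing.Theory Num.Theory.
Local Open Scope ring_scope.
Local Open Scope quotient_scope.

(* The character lattice X and the cocharacter lattice Y are both 'rV[int]_r,
   in perfect duality through [pairing].  A split reductive group enters only
   through its root datum. *)

Definition pairing r (x y : 'rV[int]_r) : int := \sum_(i < r) x 0 i * y 0 i.

(* The values of [coroot] outside [roots] are irrelevant. *)
Record root_datum (r : nat) := RootDatum {
  roots : seq 'rV[int]_r;
  coroot : 'rV[int]_r -> 'rV[int]_r;
  roots_uniq : uniq roots;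
  coroot_inj : {in roots &, injective coroot};
  pairing_coroot : {in roots, forall a, pairing a (coroot a) = 2};
  roots_refl : {in roots &, forall a b,
    b - pairing b (coroot a) *: a \in roots};
  coroots_refl : {in roots &, forall a b,
    coroot b - pairing a (coroot b) *: coroot a \in map coroot roots}
}.

Section RootDatum.
Variables (r : nat) (D : root_datum r).
Implicit Types (a b : 'rV[int]_r) (y z : 'rV[int]_r) (Delta : 'I_r -> 'rV[int]_r).

Definition coroots : seq 'rV[int]_r := map (coroot D) (roots D).

Definition reduced : Prop := {in roots D, forall a, a *+ 2 \notin roots D}.

Definition irreducible : Prop :=
  roots D <> [::] /\
  forall P : pred 'rV[int]_r,
    {in roots D &, forall a b, P a -> ~~ P b -> pairing a (coroot D b) = 0} ->
    {in roots D, forall a, P a} \/ {in roots D, forall a, ~~ P a}.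

Definition simply_connected : Prop :=
  forall y, exists c : 'rV[int]_r -> int,
    y = \sum_(a <- roots D) c a *: coroot D a.

(* The simple roots are indexed by 'I_r: for a semisimple group their number is
   the rank of Y. *)
Definition is_simple_roots Delta : Prop :=
  [/\ forall i, Delta i \in roots D,
      forall c : 'I_r -> int, \sum_i c i *: Delta i = 0 -> forall i, c i = 0
    & {in roots D, forall a, exists c : 'I_r -> nat,
        a = \sum_i Delta i *+ c i \/ a = - \sum_i Delta i *+ c i}].

Definition reflection a y : 'rV[int]_r := y - pairing a y *: coroot D a.

Inductive weyl : ('rV[int]_r -> 'rV[int]_r) -> Prop :=
| weyl_id : weyl id
| weyl_reflection a w : a \in roots D -> weyl w -> weyl (reflection a \o w).

(* A W-invariant inner product on the span of the coroots, unique up to scaling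
   in the irreducible case; it serves to compare the lengths of coroots. *)
Definition canonical_norm y : int := \sum_(a <- roots D) pairing a y ^+ 2.

Definition short_coroot y : Prop :=
  y \in coroots /\ {in coroots, forall z, canonical_norm y <= canonical_norm z}.

Definition highest_coroot Delta y : Prop :=
  y \in coroots /\
  {in coroots, forall z, exists d : 'I_r -> nat,
     y - z = \sum_i coroot D (Delta i) *+ d i}.

End RootDatum.

Definition polar r (Q : 'rV[int]_r -> int) (y z : 'rV[int]_r) : int :=
  Q (y + z) - Q y - Q z.

Record quadratic_form (r : nat) := QuadraticForm {
  qform :> 'rV[int]_r -> int;
  qformZ : forall (k : int) y, qform (k *: y) = k ^+ 2 * qform y;
  polarDl : forall x y z,
    polar qform (x + y) z = polar qform x z + polar qform y z
}.

Definition weyl_invariant r (D : root_datum r) (Q : quadratic_form r) : Prop :=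
  forall w, weyl D w -> forall y, Q (w y) = Q y.

Definition gram r (Q : quadratic_form r) : 'M[int]_r :=
  \matrix_(i, j) polar Q (delta_mx 0 i) (delta_mx 0 j).

Definition oasitic r (D : root_datum r) (Delta : 'I_r -> 'rV[int]_r)
    (Q : quadratic_form r) (n : nat) : Prop :=
  (exists c : 'I_r -> nat,
     highest_coroot D Delta (\sum_i coroot D (Delta i) *+ c i) /\
     forall i, coprime n (c i)) /\
  coprimez n%:Z (\det (gram Q)).

Section Quotient.
Variables (r : nat) (Q : quadratic_form r) (n : nat).

Definition YQn : {pred 'rV[int]_r} :=
  fun y => `[< forall z, (n%:Z %| polar Q y z)%Z >].

Lemma YQnP y : reflect (forall z, (n%:Z %| polar Q y z)%Z) (y \in YQn).
Proof. exact: asboolP. Qed.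

Fact YQn_zmod_closed : zmod_closed YQn.
Proof.
have polar0 z : polar Q 0 z = 0.
  have := polarDl Q 0 0 z; rewrite addr0.
  by move/(congr1 (fun t => t - polar Q 0 z)); rewrite subrr addrK => <-.
split=> [|x y /YQnP Hx /YQnP Hy]; apply/YQnP => z; first by rewrite polar0 dvdz0.
suff -> : polar Q (x - y) z = polar Q x z - polar Q y z by rewrite rpredB.
by apply/eqP; rewrite eq_sym subr_eq -polarDl subrK.
Qed.

HB.instance Definition _ :=
  GRing.isZmodClosed.Build 'rV[int]_r YQn YQn_zmod_closed.

Definition XQn := Quotient.quot YQn.

(* Meaningful for w in the Weyl group and Q invariant: see [actE]. *)
Definition act (w : 'rV[int]_r -> 'rV[int]_r) (x : XQn) : XQn :=
  \pi_XQn (w (repr x)).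

Definition weyl_orbit (D : root_datum r) (O : set XQn) : Prop :=
  exists x, O = [set act w x | w in weyl D]%classic.

Definition splitting (D : root_datum r) (O : set XQn) : Prop :=
  exists s : {x : XQn | O x} -> 'rV[int]_r,
    (forall u, \pi_XQn (s u) = sval u) /\
    (forall w, weyl D w -> forall u v, sval v = act w (sval u) -> s v = w (s u)).

End Quotient.

Lemma pairingDr r (x y z : 'rV[int]_r) :
  pairing x (y + z) = pairing x y + pairing x z.
Proof.
by rewrite /pairing -big_split; apply: eq_bigr => i _; rewrite mxE mulrDr.
Qed.

Lemma weylD r (D : root_datum r) w : weyl D w -> {morph w : x y / x + y}.
Proof.
elim=> // a w' _ _ IH x y /=.
by rewrite IH /reflection pairingDr scalerDl opprD addrACA.
Qed.

Lemma reflectionK r (D : root_datum r) a :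
  a \in roots D -> involutive (reflection D a).
Proof.
move=> aD y; rewrite /reflection.
have -> : pairing a (y - pairing a y *: coroot D a) = - pairing a y.
  rewrite pairingDr -scaleNr.
  have -> : pairing a (- pairing a y *: coroot D a)
            = - pairing a y * pairing a (coroot D a).
    rewrite {1 3}/pairing mulr_sumr; apply: eq_bigr => i _.
    by rewrite mxE mulrCA.
  by rewrite pairing_coroot // mulNr mulr_natr mulr2n opprD addrA subrr add0r.
by rewrite scaleNr opprK subrK.
Qed.

Lemma weyl_surj r (D : root_datum r) w z : weyl D w -> exists y, w y = z.
Proof.
move=> Ww; elim: Ww z => [|a w' aD _ IH] z; first by exists z.
by have [y Ey] := IH (reflection D a z); exists y; rewrite /= Ey reflectionK.
Qed.

Lemma actE r (D : root_datum r) (Q : quadratic_form r) n w y :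
  weyl_invariant D Q -> weyl D w ->
  act w (\pi_(XQn Q n) y) = \pi_(XQn Q n) (w y).
Proof.
move=> QW Ww; apply/eqP; rewrite -Quotient.idealrBE; apply/YQnP => z.
have [u <-] := weyl_surj z Ww.
have wB x x' : w (x - x') = w x - w x'.
  by apply/eqP; rewrite eq_sym subr_eq -(weylD Ww) subrK.
rewrite -wB /polar -(weylD Ww) !(QW _ Ww).
by move: u; apply/YQnP; rewrite Quotient.idealrBE reprK.
Qed.

(* Main.v *)
(* Write [Y] for the coroot lattice, [X] for the weight lattice and send [y] to
   the weight [B_Q(y, -)]; as [n] is prime to [det B_Q] this induces an
   isomorphism Y/nY = X/nX and Y_{Q,n} = nY.  Let the affine Weyl group
   W |x n(ZR), ZR the root lattice, act on [X]; its closed alcove is cut out by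
   the simple coroots and by [<x, theta^v> <= n], where [theta^v] is the highest
   coroot, so its vertices are [0] and [n om_i / c_i].  Every orbit of W on Y/nY
   has a representative whose weight is congruent modulo n(ZR) to a point [x] of
   this alcove.  An element [w] of [W] that fixes the class of [x] gives an
   affine transformation fixing [x], which is then a product of simple
   reflections in walls through [x] and hence also fixes every vertex
   [n om_i / c_i] opposite to a wall missing [x].  Subtracting,
   [w] fixes [c_i x - n om_i], a lift of [c_i x].  As [c_i] and [det B_Q] are
   invertible modulo [n], this yields a lift of the class in [Y] that is fixed
   by its stabiliser, which is all that a splitting requires. *)
Require Import Defs.
From mathcomp Require Import all_boot order ssralg ssrnum ssrint intdiv zmodp
  matrix.
From mathcomp Require Import generic_quotient ring_quotient.
From mathcomp Require Import boolp classical_sets.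
From mathcomp Require Import ring zify.
Set Implicit Arguments.
Unset Strict Implicit.
Unset Printing Implicit Defensive.
Import Order.TTheory GRing.Theory Num.Theory.
Local Open Scope ring_scope.
Local Open Scope quotient_scope.

(** * Bilinearity and nondegeneracy of the pairing *)

Section Pairing.
Variable r : nat.
Implicit Types x y z : 'rV[int]_r.

Lemma pairingC x y : pairing x y = pairing y x.
Proof. by apply: eq_bigr => i _; rewrite mulrC. Qed.

Lemma pairingDl x y z : pairing (x + y) z = pairing x z + pairing y z.
Proof. by rewrite pairingC pairingDr !(pairingC z). Qed.

Lemma pairingZr k x y : pairing x (k *: y) = k * pairing x y.
Proof. by rewrite /pairing mulr_sumr; apply: eq_bigr => i _;
  rewrite mxE mulrCA. Qed.

Lemma pairingZl k x y : pairing (k *: x) y = k * pairing x y.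
Proof. by rewrite pairingC pairingZr pairingC. Qed.

Lemma pairingNr x y : pairing x (- y) = - pairing x y.
Proof. by rewrite -scaleN1r pairingZr mulN1r. Qed.

Lemma pairingNl x y : pairing (- x) y = - pairing x y.
Proof. by rewrite pairingC pairingNr pairingC. Qed.

Lemma pairing0l y : pairing 0 y = 0.
Proof. by rewrite -(scale0r 0) pairingZl mul0r. Qed.

Lemma pairing0r y : pairing y 0 = 0.
Proof. by rewrite pairingC pairing0l. Qed.

Definition pairingE :=
  (pairingDl, pairingDr, pairingNl, pairingNr, pairingZl, pairingZr,
   pairing0l, pairing0r).

Lemma pairing_sumr (I : Type) (s : seq I) P (F : I -> 'rV[int]_r) x :
  pairing x (\sum_(i <- s | P i) F i) = \sum_(i <- s | P i) pairing x (F i).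
Proof. by apply: (big_morph (pairing x)) => [y z|]; rewrite pairingE. Qed.

Lemma pairing_delta x i : pairing x (delta_mx 0 i) = x 0 i.
Proof.
rewrite /pairing (bigD1 i) //= big1 => [|j ne_ji]; rewrite mxE eqxx /=.
  by rewrite eqxx mulr1 addr0.
by rewrite (negPf ne_ji) mulr0.
Qed.

Lemma pairing_injl x x' : (forall y, pairing x y = pairing x' y) -> x = x'.
Proof. by move=> eq_xx'; apply/rowP => i; rewrite -!pairing_delta. Qed.

Lemma pairing_injr y y' : (forall x, pairing x y = pairing x y') -> y = y'.
Proof. by move=> eq_yy'; apply: pairing_injl => x; rewrite !(pairingC _ x). Qed.

End Pairing.

(** * Reflections of characters and the invariant form on roots *)

Section RootDatum.
Variables (r : nat) (D : root_datum r).
Implicit Types (a b x : 'rV[int]_r) (y z : 'rV[int]_r).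
Local Notation R := (Defs.roots D).
Local Notation "a ^v" := (coroot D a) (at level 2, format "a ^v").

Definition root_refl a x := x - pairing x a^v *: a.

Lemma root_reflE a x y :
  pairing (root_refl a x) y = pairing x (reflection D a y).
Proof. by rewrite /root_refl /reflection !pairingE; ring. Qed.

Lemma root_reflK a : a \in R -> involutive (root_refl a).
Proof.
by move=> aR x; apply: pairing_injl => y; rewrite !root_reflE reflectionK.
Qed.

Lemma root_refl_self a : a \in R -> root_refl a a = - a.
Proof.
move=> aR; rewrite /root_refl pairing_coroot // scaler_nat mulr2n.
by rewrite opprD addrA subrr sub0r.
Qed.

Lemma root_refl_root a b : a \in R -> b \in R -> root_refl a b \in R.
Proof. exact: roots_refl. Qed.

(* Summing over the coroots gives an inner product on the root lattice which is
   invariant because reflections permute the coroots. *)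
Definition rform x y : int := \sum_(b <- R) pairing x b^v * pairing y b^v.

Lemma rformC x y : rform x y = rform y x.
Proof. by apply: eq_bigr => b _; rewrite mulrC. Qed.

Lemma rformDl x y z : rform (x + y) z = rform x z + rform y z.
Proof. by rewrite -big_split; apply: eq_bigr => b _;
  rewrite pairingE mulrDl. Qed.

Lemma rformZl k x z : rform (k *: x) z = k * rform x z.
Proof. by rewrite mulr_sumr; apply: eq_bigr => b _; rewrite pairingE mulrA. Qed.

Lemma rformDr x y z : rform x (y + z) = rform x y + rform x z.
Proof. by rewrite rformC rformDl !(rformC x). Qed.

Lemma rformZr k x z : rform x (k *: z) = k * rform x z.
Proof. by rewrite rformC rformZl rformC. Qed.

Lemma rform_ge0 x : 0 <= rform x x.
Proof. by apply: sumr_ge0 => b _; rewrite -expr2 sqr_ge0. Qed.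

Lemma rform_gt0 a : a \in R -> 0 < rform a a.
Proof.
move=> aR; rewrite /rform (big_rem a) //= pairing_coroot //.
by apply: ltr_wpDr => //; apply: sumr_ge0 => b _; rewrite -expr2 sqr_ge0.
Qed.

Lemma reflection_inj a : a \in R -> injective (reflection D a).
Proof. by move=> aR; apply: inv_inj; apply: reflectionK. Qed.

Lemma rform_root_refl a x y : a \in R ->
  rform (root_refl a x) (root_refl a y) = rform x y.
Proof.
move=> aR; rewrite /rform.
under eq_bigr do rewrite !root_reflE.
rewrite -(big_map (coroot D) xpredT (fun z => pairing x (reflection D a z)
  * pairing y (reflection D a z))) -(big_map (reflection D a) xpredT
  (fun z => pairing x z * pairing y z)).
rewrite -(big_map (coroot D) xpredT (fun z => pairing x z * pairing y z)).
apply: perm_big.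
have uC : uniq (map (coroot D) R).
  by rewrite map_inj_in_uniq ?roots_uniq //; apply: coroot_inj.
have uS : uniq (map (reflection D a) (map (coroot D) R)).
  by rewrite map_inj_uniq //; apply: reflection_inj.
have subS : {subset map (reflection D a) (map (coroot D) R) <=
    map (coroot D) R}.
  by move=> _ /mapP[_ /mapP[b bR ->] ->]; apply: coroots_refl.
have [|_ eqS] := uniq_min_size uS subS; first by rewrite !size_map.
exact: uniq_perm.
Qed.

(** Invariance under the reflection in [a], which negates [a]. This is the classical formula
    expressing a coroot as [2 a / (a, a)]. *)
Lemma rform_root a x : a \in R -> 2 * rform x a = rform a a * pairing x a^v.
Proof.
move=> aR; have := rform_root_refl x a aR.
have -> := root_refl_self aR.
rewrite -[- a]scaleN1r rformZr /root_refl -scaleNr rformDl rformZl => E.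
by rewrite mulr_natl mulr2n -[X in X + _]E; ring.
Qed.

(** The axioms only say that a reflected coroot is some coroot. By [rform_root] the invariant form
    determines which one, so passing from roots to coroots commutes with reflections. *)
Lemma coroot_root_refl a b : a \in R -> b \in R ->
  (root_refl a b)^v = reflection D a b^v.
Proof.
move=> aR bR; apply: pairing_injr => x.
have cR : root_refl a b \in R by apply: root_refl_root.
apply: (mulfI (lt0r_neq0 (rform_gt0 cR))).
rewrite -rform_root // rform_root_refl // -root_reflE -rform_root //.
by rewrite -(rform_root_refl _ _ aR) root_reflK.
Qed.

Lemma oppr_root a : a \in R -> - a \in R /\ (- a)^v = - a^v.
Proof.
move=> aR; have <- := root_refl_self aR.
split; first exact: root_refl_root.
rewrite coroot_root_refl // /reflection pairing_coroot // scaler_nat mulr2n.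
by rewrite opprD addrA subrr sub0r.
Qed.

(** Both sides have the sign of [rform D a b]. *)
Lemma pairing_gt0C a b : a \in R -> b \in R ->
  (0 < pairing a b^v) = (0 < pairing b a^v).
Proof.
move=> aR bR.
rewrite -(pmulr_rgt0 _ (rform_gt0 bR)) -rform_root // rformC rform_root //.
by rewrite pmulr_rgt0 // rform_gt0.
Qed.

End RootDatum.

(** * Positive roots *)

Section PositiveRoots.
Variables (r : nat) (D : root_datum r) (Delta : 'I_r -> 'rV[int]_r).
Local Notation R := (Defs.roots D).
Local Notation "a ^v" := (coroot D a) (at level 2, format "a ^v").
Hypothesis reducedR : reduced D.
Hypothesis simpleD : is_simple_roots D Delta.

Lemma simple_root i : Delta i \in R.
Proof. by have [] := simpleD. Qed.
Hint Resolve simple_root : core.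

(** The fundamental weights; [dual_basis] provides them. *)
Variable om : 'I_r -> 'rV[int]_r.
Hypothesis omD : forall i j, pairing (om i) (Delta j)^v = (i == j)%:R.
Hypothesis omE : forall y, y = \sum_i pairing (om i) y *: (Delta i)^v.
Local Notation co i a := (pairing (om i) a^v).

Lemma pairing_coef x y :
  pairing x y = \sum_i pairing (om i) y * pairing x (Delta i)^v.
Proof.
by rewrite {1}[y]omE pairing_sumr; apply: eq_bigr => i _; rewrite pairingE.
Qed.

Lemma coef_inj a b : a \in R -> b \in R -> (forall i, co i a = co i b) -> a = b.
Proof.
move=> aR bR E; apply: (coroot_inj aR bR).
by rewrite [LHS]omE [RHS]omE; apply: eq_bigr => i _; rewrite E.
Qed.

(** Simple roots control the signs of the coefficients of [a], while positivity is read below on its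
    coroot. Computing [rform] of [a] and [om i] in two ways shows that the two kinds of coefficients
    differ by positive factors. *)
Lemma root_coef a : a \in R -> exists m : 'I_r -> int,
  [/\ a = \sum_i m i *: Delta i,
      forall i, rform D a a * co i a = m i * rform D (Delta i) (Delta i)
    & (forall i, 0 <= m i) \/ (forall i, m i <= 0)].
Proof.
move=> aR; have [_ _ /(_ _ aR)[f fE]] := simpleD.
have main (m : 'I_r -> int) : a = \sum_i m i *: Delta i ->
    forall i, rform D a a * co i a = m i * rform D (Delta i) (Delta i).
  move=> aE i; rewrite -rform_root // {1}aE rformC.
  rewrite (big_morph (fun x => rform D x (om i)) (id1 := 0) (op1 := +%R));
    first last.
  - by rewrite -(scale0r 0) rformZl mul0r.
  - by move=> x y; rewrite rformDl.
  rewrite mulr_sumr (bigD1 i) //= big1 => [|j ne_ji].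
    by rewrite rformZl mulrCA rformC rform_root // omD eqxx mulr1 addr0.
  rewrite rformZl mulrCA rformC rform_root // omD eq_sym (negPf ne_ji).
  by rewrite !mulr0.
case: fE => aE.
  exists (fun i => (f i)%:Z); have aE' : a = \sum_i (f i)%:Z *: Delta i.
    by rewrite aE; apply: eq_bigr => i _; rewrite -scaler_nat natz.
  by split => //; [apply: main | left].
exists (fun i => - (f i)%:Z); have aE' : a = \sum_i (- (f i)%:Z) *: Delta i.
  rewrite aE -sumrN; apply: eq_bigr => i _.
  by rewrite -scaler_nat natz scaleNr.
by split => //; [apply: main | right => i; rewrite oppr_le0].
Qed.

Definition pos a := [forall i, 0 <= co i a].

Lemma pos_or_neg a : a \in R -> pos a \/ pos (- a).
Proof.
move=> aR; have [m [_ Em [m0|m0]]] := root_coef aR; [left | right];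
  apply/forallP => i; have gi := rform_gt0 (simple_root i);
  rewrite ?(oppr_root aR).2 ?pairingE -(pmulr_rge0 _ (rform_gt0 aR)) ?mulrN Em.
  by rewrite mulr_ge0 // ltW.
by rewrite oppr_ge0 mulr_le0_ge0 // ltW.
Qed.

Lemma coef_neq0 a : a \in R -> ~ (forall i, co i a = 0).
Proof.
move=> aR a0; have := pairing_coroot aR; rewrite [a^v]omE big1 ?pairingE //.
by move=> i _; rewrite a0 scale0r.
Qed.

Lemma pos_coef a i : a \in R -> 0 < co i a -> pos a.
Proof.
move=> aR ai; have [//|/forallP/(_ i)] := pos_or_neg aR.
by rewrite (oppr_root aR).2 pairingE; lia.
Qed.

Lemma pos_opp a : a \in R -> pos (- a) = ~~ pos a.
Proof.
move=> aR; apply/idP/idP => [na|/negP pa]; last by have [] := pos_or_neg aR.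
apply/negP => pa; apply: (coef_neq0 aR) => i.
move/forallP: na => /(_ i); move/forallP: pa => /(_ i).
by rewrite (oppr_root aR).2 pairingE; lia.
Qed.

Lemma pos_simple i : pos (Delta i).
Proof. by apply/forallP => j; rewrite omD; case: eqP. Qed.

Lemma coef_root_refl a b i : a \in R -> b \in R ->
  co i (root_refl D a b) = co i b - pairing a b^v * co i a.
Proof. by move=> aR bR; rewrite coroot_root_refl // /reflection !pairingE. Qed.

(** Only coefficient [i] changes, so a positive coefficient elsewhere keeps the root positive. If
    there is none, [a] is a multiple of [Delta i], hence equal to it. *)
Lemma pos_root_refl a i : a \in R -> pos a -> a != Delta i ->
  pos (root_refl D (Delta i) a).
Proof.
move=> aR pa ne_ai; have sR := root_refl_root (simple_root i) aR.
have [[j /andP[ne_ji aj]]|noj] := pselect (exists j, (j != i) && (0 < co j a)).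
  by apply: (pos_coef (i := j)) => //;
    rewrite coef_root_refl // omD (negPf ne_ji) mulr0 subr0.
have aj0 j : j != i -> co j a = 0.
  move=> ne_ji; apply/eqP; rewrite eq_le (forallP pa j) andbT leNgt.
  by apply/negP => aj; apply: noj; exists j; rewrite ne_ji.
have [m [aE mE _]] := root_coef aR.
have {}aE : a = m i *: Delta i.
  rewrite aE (bigD1 i) //= big1 ?addr0 // => j ne_ji.
  have /esym/eqP := mE j; rewrite aj0 // mulr0 mulf_eq0.
  by rewrite (gt_eqF (rform_gt0 (simple_root j))) orbF => /eqP->;
    rewrite scale0r.
have m2 : m i * pairing (Delta i) a^v = 2.
  by rewrite -pairingZl -aE pairing_coroot.
have mi_ge0 : 0 <= m i.
  rewrite -(pmulr_lge0 _ (rform_gt0 (simple_root i))) -mE mulr_ge0 //.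
    exact: rform_ge0.
  exact: (forallP pa i).
(* The pairing of [a] with its coroot is 2, so [m i] divides 2; the value 2 would contradict
   reducedness. *)
have [m1|m22] : m i = 1 \/ m i = 2.
  move: (m i) (pairing _ _) m2 mi_ge0 => m' p m2 m_ge0.
  have p_gt0 : 0 < p by nia.
  by nia.
  by rewrite aE m1 scale1r eqxx in ne_ai.
have := reducedR (simple_root i).
by rewrite -scaler_nat -[2%:R]m22 -aE aR.
Qed.

End PositiveRoots.

(** * The highest coroot and the affine Weyl group *)

Section Highest.
Variables (r : nat) (D : root_datum r) (Delta : 'I_r -> 'rV[int]_r).
Variables (theta : 'rV[int]_r) (c : 'I_r -> nat).
Local Notation R := (Defs.roots D).
Local Notation "a ^v" := (coroot D a) (at level 2, format "a ^v").
Hypothesis reducedR : reduced D.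
Hypothesis simpleD : is_simple_roots D Delta.
Hypothesis thetaR : theta \in R.
Hypothesis theta_coroot : theta^v = \sum_i (Delta i)^v *+ c i.
Hypothesis theta_top : {in coroots D, forall z, exists d : 'I_r -> nat,
  theta^v - z = \sum_i (Delta i)^v *+ d i}.
Let simpleR i : Delta i \in R := simple_root simpleD i.
Hint Resolve simpleR : core.

(** Every coroot is the highest one minus simple coroots, so the simple coroots span [Y]. The square
    integral matrix [C] of their coordinates is then invertible, and the columns of its inverse are
    the fundamental weights. *)
Lemma dual_basis : simply_connected D ->
  exists om : 'I_r -> 'rV[int]_r,
    (forall i j, pairing (om i) (Delta j)^v = (i == j)%:R) /\
    (forall y, y = \sum_i pairing (om i) y *: (Delta i)^v).
Proof.
move=> sc; pose C := \matrix_i (Delta i)^v.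
have spanR a : a \in R -> exists e : 'rV_r, a^v = e *m C.
  move=> aR; have [d Ed] := theta_top (map_f (coroot D) aR).
  exists (\row_i ((c i)%:Z - (d i)%:Z)).
  rewrite mulmx_sum_row -[LHS](subKr theta^v) Ed theta_coroot -sumrB.
  apply: eq_bigr => i _; rewrite rowK mxE scalerBl -!scaler_nat.
  by rewrite !natz.
have spanY y : exists e : 'rV_r, y = e *m C.
  have [f ->] := sc y; rewrite big_seq;
    elim/big_ind: _ => [|_ _ [e1 ->] [e2 ->]|a aR].
  - by exists 0; rewrite mul0mx.
  - by exists (e1 + e2); rewrite mulmxDl.
  by have [e ->] := spanR a aR; exists (f a *: e); rewrite scalemxAl.
have [E defE] := choice (fun i : 'I_r => spanY (delta_mx 0 i)).
pose M := \matrix_i E i.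
have MC : M *m C = 1%:M.
  apply/row_matrixP => i; rewrite row_mul rowK -defE.
  by rewrite row1.
have CM := mulmx1C MC.
have omE i y : pairing (row i M^T) y = (y *m M) 0 i.
  by rewrite mxE; apply: eq_bigr => j _; rewrite !mxE mulrC.
exists (fun i => row i M^T); split => [i j|y].
  rewrite omE -[(Delta j)^v](rowK (fun j => (Delta j)^v)) -row_mul CM.
  by rewrite !mxE eq_sym.
rewrite -[LHS]mulmx1 -MC mulmxA mulmx_sum_row.
by apply: eq_bigr => i _; rewrite omE rowK.
Qed.

Variable om : 'I_r -> 'rV[int]_r.
Hypothesis omD : forall i j, pairing (om i) (Delta j)^v = (i == j)%:R.
Hypothesis omE : forall y, y = \sum_i pairing (om i) y *: (Delta i)^v.
Local Notation co i a := (pairing (om i) a^v).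
Local Notation pos := (pos D om).

Lemma coef_theta i : co i theta = c i.
Proof.
rewrite theta_coroot pairing_sumr (bigD1 i) //= big1 => [|j ne_ji].
  by rewrite -scaler_nat pairingE omD eqxx mulr1 addr0 natz.
by rewrite -scaler_nat pairingE omD eq_sym (negPf ne_ji) mulr0.
Qed.

Lemma coef_le a i : a \in R -> co i a <= c i.
Proof.
move=> aR; have [d /(congr1 (pairing (om i)))] :=
  theta_top (map_f (coroot D) aR).
rewrite !pairingE coef_theta pairing_sumr (bigD1 i) //= big1 => [|j ne_ji].
  by rewrite -scaler_nat pairingE omD eqxx mulr1 addr0 natz; lia.
by rewrite -scaler_nat pairingE omD eq_sym (negPf ne_ji) mulr0.
Qed.

Lemma coef_ge a i : a \in R -> - (c i)%:Z <= co i a.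
Proof.
move=> aR; have [naR nav] := oppr_root aR.
by have := coef_le i naR; rewrite nav pairingE; lia.
Qed.

(** Otherwise reflecting [theta] in [Delta i] would raise coefficient [i] above its maximum
    [c i]. *)
Lemma theta_dominant i : 0 <= pairing theta (Delta i)^v.
Proof.
have [nR nv] := oppr_root thetaR.
rewrite leNgt; apply/negP => lt0.
have: 0 < pairing (- theta) (Delta i)^v by rewrite pairingE oppr_gt0.
rewrite pairing_gt0C // nv pairingE oppr_gt0 => lt0'.
have := coef_le i (root_refl_root (simpleR i) thetaR).
by rewrite coef_root_refl // coef_theta omD eqxx; lia.
Qed.

Lemma theta_pos a : pos a -> 0 <= pairing theta a^v.
Proof.
move=> /forallP pa; rewrite (pairing_coef omE); apply: sumr_ge0 => i _.
by rewrite mulr_ge0 // theta_dominant.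
Qed.

(* The pair [(a, k)] is the affine function [<x, a^v> + k l] on level [l]. *)
Local Notation aroot := ('rV[int]_r * int)%type.
Implicit Types (s t : aroot) (v : 'rV[int]_r * int).

Definition aval s v : int := pairing v.1 (s.1)^v + s.2 * v.2.
(** Keeping the level as a coordinate makes the affine action linear: the vertex [n om_i / c_i]
    becomes the integral point [om i] at level [c i]. *)
Definition arefl s v := (v.1 - aval s v *: s.1, v.2).
Definition aroot_refl t s : aroot :=
  (root_refl D t.1 s.1, s.2 - pairing t.1 (s.1)^v * t.2).

Lemma aval_arefl t s v : t.1 \in R -> s.1 \in R ->
  aval s (arefl t v) = aval (aroot_refl t s) v.
Proof.
move=> tR sR; rewrite /aval /= coroot_root_refl // /reflection !pairingE /aval.
by ring.
Qed.

Lemma aval_arefl_self s v : s.1 \in R -> aval s (arefl s v) = - aval s v.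
Proof.
move=> sR; rewrite {1}/aval /= !pairingE pairing_coroot // /aval; ring.
Qed.

Lemma areflK s : s.1 \in R -> involutive (arefl s).
Proof.
move=> sR v; rewrite {1}/arefl aval_arefl_self //= scaleNr opprK subrK.
by case: v.
Qed.

Lemma arefl_conj t s v : t.1 \in R -> s.1 \in R ->
  arefl (aroot_refl t s) v = arefl t (arefl s (arefl t v)).
Proof.
move=> tR sR; rewrite {1}/arefl -aval_arefl //.
rewrite -[X in X.1 - _](areflK tR v) -[v.2]/((arefl t v).2).
move: (arefl t v) => u; rewrite /arefl /=; congr (_, _).
rewrite /aval /= !pairingE /root_refl.
by apply/rowP => i; rewrite !mxE; ring.
Qed.

(** * Positive and simple affine roots *)

Definition apos s := (s.1 \in R) && ((0 < s.2) || (s.2 == 0) && pos s.1).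

(** [None] stands for the affine wall, where the pairing with the highest coroot equals the
    level. *)
Definition simple_aroot (i : option 'I_r) : aroot :=
  if i is Some j then (Delta j, 0) else (- theta, 1).

Lemma simple_aroot_root i : (simple_aroot i).1 \in R.
Proof. by case: i => [i|] //=; have [] := oppr_root thetaR. Qed.
Hint Resolve simple_aroot_root : core.

Lemma apos_simple i : apos (simple_aroot i).
Proof.
rewrite /apos simple_aroot_root; case: i => [i|] //=.
exact: (pos_simple omD).
Qed.

(** At a finite wall [k] is unchanged and [pos_root_refl] applies. At the affine wall [k] becomes
    [k + m], where [m] pairs [theta] with the coroot of [a]. If [m < 0], then [k > 0] and the
    reflected root is positive, so [k + m >= 0] suffices. *)
Lemma apos_refl s i : apos s -> s != simple_aroot i ->
  apos (aroot_refl (simple_aroot i) s).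
Proof.
case: s => a k /andP[/= aR]; case: i => [i|] /= Pa ne_s; rewrite /apos /=.
  rewrite root_refl_root //= mulr0 subr0;
    case/orP: Pa => [-> //|/andP[/eqP k0 pa]].
  rewrite k0 /= (pos_root_refl reducedR simpleD omD) //;
    apply: contra ne_s => /eqP->.
  by rewrite k0.
have [nR nv] := oppr_root thetaR.
have bR : root_refl D (- theta) a \in R by rewrite root_refl_root.
rewrite bR /= mulr1 pairingE opprK.
have bE i : co i (root_refl D (- theta) a) = co i a - pairing theta a^v * c i.
  by rewrite coef_root_refl // nv !pairingE coef_theta; ring.
have bT : pairing theta (root_refl D (- theta) a)^v = - pairing theta a^v.
  rewrite coroot_root_refl // /reflection nv !pairingE pairing_coroot //; ring.
set m := pairing theta a^v in bE bT *.
have [m0|m0] := leP 0 m.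
  apply/orP; have [n0|n0] := boolP (0 < k + m); [by left | right].
  have Pk : (k == 0) && pos a by case/orP: Pa => // k0; exfalso; lia.
  case/andP: Pk => k0 /forallP pa; have -> : k + m == 0 by lia.
  apply/forallP => i; rewrite bE; have -> : m = 0 by lia.
  by rewrite mul0r subr0.
have pb : pos (root_refl D (- theta) a).
  have [//|/theta_pos] := pos_or_neg simpleD omD bR.
  by rewrite (oppr_root bR).2 pairingE bT; lia.
rewrite pb andbT.
have k_gt0 : 0 < k.
  by case/orP: Pa => // /andP[_ /theta_pos]; rewrite -/m; lia.
have [m1|m1] := leP (-1) m; first by lia.
(* For [m <= -2], the lower bound [- c i] on the coefficients of [a] and the upper bound [c i] on
   the reflected ones force equality. Then [m = -2], and [k >= 2] because [s] is not the affine
   simple root. *)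
have aE : a = - theta.
  apply: (coef_inj omE) => // i; have := coef_le i bR;
    rewrite bE nv pairingE coef_theta.
  by have := coef_ge i aR; nia.
have m2 : m = - 2 by rewrite /m aE nv pairingE pairing_coroot.
have k1 : k != 1 by apply: contra ne_s => /eqP ->; rewrite aE.
lia.
Qed.

(** * Generation of affine reflections by the simple ones *)

Definition wact (l : seq (option 'I_r)) v :=
  foldr (fun i => arefl (simple_aroot i)) v l.

Lemma wact_cat l1 l2 v : wact (l1 ++ l2) v = wact l1 (wact l2 v).
Proof. exact: foldr_cat. Qed.

(** The height over the simple affine roots. The constant function equal to the level is the affine
    one plus [c i] times each finite one, whence the factor of [s.2]. *)
Definition aht s : int := \sum_i co i s.1 + s.2 * (1 + \sum_i (c i)%:Z).

Lemma aht_ge0 s : apos s -> 0 <= aht s.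
Proof.
case: s => a k /andP[/= aR] /orP[k0|/andP[/eqP-> /forallP pa]]; rewrite /aht /=.
  have sum_ge0 : 0 <= \sum_i (co i a + (c i)%:Z).
    by apply: sumr_ge0 => i _; have := coef_ge i aR; lia.
  have c_ge0 : 0 <= \sum_i (c i)%:Z by apply: sumr_ge0.
  move: sum_ge0 c_ge0; rewrite big_split /=.
  move: (\sum_i co i a) (\sum_i (c i)%:Z) => A B; nia.
by rewrite mul0r addr0; apply: sumr_ge0.
Qed.

Lemma aht_simple i : aht (simple_aroot i) = 1.
Proof.
case: i => [i|]; rewrite /aht /=.
  rewrite mul0r addr0 (bigD1 i) //= omD eqxx big1 ?addr0 // => j ne_ji.
  by rewrite omD (negPf ne_ji).
rewrite (oppr_root thetaR).2.
under eq_bigr do rewrite pairingE coef_theta.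
by rewrite sumrN mul1r addrC addrK.
Qed.

Lemma aht_refl s i : s.1 \in R -> aht (aroot_refl (simple_aroot i) s) =
  aht s - pairing (simple_aroot i).1 (s.1)^v.
Proof.
move=> sR; set m := pairing _ _.
rewrite -[m]mulr1 -(aht_simple i) /aht /aroot_refl /= -/m.
under eq_bigr do rewrite coef_root_refl // -/m.
by rewrite sumrB -mulr_sumr; ring.
Qed.

(** If all these pairings were nonpositive, [a] would pair to 0 with the highest coroot. One of the
    coroot of [a] and its sum with the highest coroot is a nonnegative combination of simple
    coroots, so 2 would be nonpositive. *)
Lemma apos_descent s : apos s ->
  exists i, 0 < pairing s.1 ((simple_aroot i).1)^v.
Proof.
case: s => a k /andP[/= aR Pa]; apply: contrapT => no.
have le0 i : pairing a (Delta i)^v <= 0.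
  by rewrite leNgt; apply/negP => ?; apply: no; exists (Some i).
have th_ge0 : 0 <= pairing a theta^v.
  rewrite leNgt; apply/negP => ?; apply: no; exists None => /=.
  by rewrite (oppr_root thetaR).2 pairingE oppr_gt0.
have th_le0 : pairing a theta^v <= 0.
  rewrite (pairing_coef omE); apply: sumr_le0 => i _.
  by rewrite coef_theta mulr_ge0_le0.
have := pairing_coroot aR; case/orP: Pa => [_|/andP[_ /forallP pa]].
  have: pairing a (a^v + theta^v) <= 0.
    rewrite (pairing_coef omE); apply: sumr_le0 => i _.
    apply: mulr_ge0_le0 => //; rewrite pairingE coef_theta.
    by have := coef_ge i aR; lia.
  by rewrite pairingE; lia.
rewrite (pairing_coef omE) => E.
suff: \sum_i co i a * pairing a (Delta i)^v <= 0 by rewrite E.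
by apply: sumr_le0 => i _; rewrite mulr_ge0_le0.
Qed.

(** Induction on the height: a simple reflection given by [apos_descent] lowers it, keeps [s]
    positive unless [s] is simple, and conjugates the reflections. *)
Lemma apos_word s : apos s -> exists l, forall v, wact l v = arefl s v.
Proof.
have [m] := ubnP (absz (aht s)); elim: m s => // m IHm s le_m Ps.
have sR : s.1 \in R by case/andP: Ps.
have [i] := apos_descent Ps; rewrite pairing_gt0C // => gt0.
have [->|ne_s] := eqVneq s (simple_aroot i); first by exists [:: i].
have Pt := apos_refl Ps ne_s.
have := aht_refl i sR; have := aht_ge0 Ps; have := aht_ge0 Pt => ht ht' E.
have [|l lE] := IHm _ _ Pt; first by lia.
exists (i :: l ++ [:: i]) => v; rewrite /= wact_cat lE /= arefl_conj //.
by rewrite !areflK.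
Qed.

Lemma aroot_word s : s.1 \in R -> exists l, forall v, wact l v = arefl s v.
Proof.
move=> sR; have [Ps|nPs] := boolP (apos s); first exact: apos_word.
have [nR nv] := oppr_root sR.
(* An affine root and its negative define the same reflection. *)
have Pt : apos (- s.1, - s.2).
  move: nPs; rewrite /apos sR nR /= (pos_opp simpleD omD omE) //;
    case: (pos s.1) => /=; lia.
have [l lE] := apos_word Pt; exists l => v; rewrite lE /arefl /aval /= nv.
by rewrite pairingE mulNr -opprD scalerN scaleNr opprK.
Qed.

(** * Exchange property and stabilisers in the alcove *)

Definition word_aroot (l : seq (option 'I_r)) s :=
  foldl (fun s i => aroot_refl (simple_aroot i) s) s l.

Lemma aval_wact l s v : s.1 \in R ->
  aval s (wact l v) = aval (word_aroot l s) v.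
Proof.
elim: l s => //= i l IH s sR.
by rewrite aval_arefl // IH //; apply: root_refl_root.
Qed.

(** Where the root first turns negative along the word it equals the simple root of the current
    letter, by [apos_refl]. Deleting that letter amounts to composing with the reflection in [s]. *)
Lemma wact_exchange l s : apos s -> ~~ apos (word_aroot l s) ->
  exists l', (size l' < size l)%N /\ forall v, wact l' v = arefl s (wact l v).
Proof.
elim: l s => [|i l IH] s Ps /=; first by rewrite Ps.
have sR : s.1 \in R by case/andP: Ps.
have [->|ne_s] := eqVneq s (simple_aroot i).
  by exists l; split => // v; rewrite areflK.
move=> /(IH _ (apos_refl Ps ne_s))[l' [sz lE]].
by exists (i :: l'); split => // v; rewrite /= lE arefl_conj // areflK.
Qed.

Definition in_alcove v := forall i, 0 <= aval (simple_aroot i) v.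

(** A positive affine root is a nonnegative combination of walls and of the level; for [k > 0] the
    highest coroot is added and subtracted. *)
Lemma in_alcoveP v s : in_alcove v -> 0 <= v.2 -> apos s -> 0 <= aval s v.
Proof.
case: s v => a k [x n] xA /= n0 /andP[/= aR Pa].
have dom i : 0 <= pairing x (Delta i)^v.
  by have := xA (Some i); rewrite /aval /= mul0r addr0.
have top : 0 <= n - pairing x theta^v.
  have := xA None; rewrite /aval /= (oppr_root thetaR).2 pairingE mul1r; lia.
rewrite /aval /=; case/orP: Pa => [k0|/andP[/eqP-> /forallP pa]].
  have: 0 <= pairing x (a^v + theta^v).
    rewrite (pairing_coef omE); apply: sumr_ge0 => i _; apply: mulr_ge0 => //.
    by rewrite pairingE coef_theta; have := coef_ge i aR; lia.
  by rewrite pairingE; nia.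
rewrite mul0r addr0 (pairing_coef omE); apply: sumr_ge0 => i _; exact: mulr_ge0.
Qed.

(* The stabiliser of [v] is generated by the simple reflections in the walls
   through [v]. *)
Lemma wact_fix l v u : in_alcove v -> 0 <= v.2 ->
    (forall i, aval (simple_aroot i) v = 0 -> aval (simple_aroot i) u = 0) ->
  wact l v = v -> wact l u = u.
Proof.
move=> vA v0 uv; have [m] := ubnP (size l);
  elim: m l => // m IHm [//|i l] /= sz.
have [Pt|nPt] := boolP (apos (word_aroot l (simple_aroot i))).
  have := in_alcoveP vA v0 Pt; rewrite -aval_wact // => ge0 fixv.
  have: aval (simple_aroot i) v <= 0.
    by rewrite -fixv aval_arefl_self // oppr_le0.
  have := vA i => ge0' le0; have i0 : aval (simple_aroot i) v = 0 by lia.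
  have arefl0 w : aval (simple_aroot i) w = 0 -> arefl (simple_aroot i) w = w.
    by move=> w0; rewrite /arefl w0 scale0r subr0; case: w {w0}.
  rewrite IHm //; first by apply/arefl0/uv.
  by rewrite -[LHS](areflK (simple_aroot_root i)) fixv arefl0.
have [l' [sz' lE]] := wact_exchange (apos_simple i) nPt.
by rewrite -!lE; apply: IHm; lia.
Qed.

End Highest.

(** * The root lattice and words in the finite Weyl group *)

Section RootLattice.
Variables (r : nat) (D : root_datum r).
Local Notation R := (Defs.roots D).
Local Notation "a ^v" := (coroot D a) (at level 2, format "a ^v").
Implicit Types (a x : 'rV[int]_r) (l : seq 'rV[int]_r).

Inductive root_lattice : 'rV[int]_r -> Prop :=
| root_lattice0 : root_lattice 0
| root_lattice_add a k x :
    a \in R -> root_lattice x -> root_lattice (x + k *: a).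

Lemma root_latticeD x y :
  root_lattice x -> root_lattice y -> root_lattice (x + y).
Proof.
move=> Lx; elim=> [|a k z aR _ IH]; first by rewrite addr0.
by rewrite addrA; apply: root_lattice_add.
Qed.

Lemma root_latticeN x : root_lattice x -> root_lattice (- x).
Proof.
elim=> [|a k z aR _ IH]; first by rewrite oppr0; apply: root_lattice0.
by rewrite opprD -scaleNr; apply: root_lattice_add.
Qed.

Lemma root_latticeZ k a : a \in R -> root_lattice (k *: a).
Proof.
by move=> aR; rewrite -[_ *: _]add0r; apply: root_lattice_add => //;
  apply: root_lattice0.
Qed.

(** One word of roots describes the same Weyl element on both lattices, whereas [weyl] only knows
    its action on [Y]. *)
Definition weylX l x := foldr (root_refl D) x l.
Definition weylY l y := foldr (reflection D) y l.

Lemma weylXD l x y : weylX l (x + y) = weylX l x + weylX l y.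
Proof.
elim: l => //= a l ->; rewrite /root_refl pairingE scalerDl opprD.
by rewrite addrACA.
Qed.

Lemma weylXZ l k x : weylX l (k *: x) = k *: weylX l x.
Proof.
by elim: l => //= a l ->; rewrite /root_refl pairingE scalerBr scalerA.
Qed.

Lemma weylYZ l k y : weylY l (k *: y) = k *: weylY l y.
Proof.
by elim: l => //= a l ->; rewrite /reflection pairingE scalerBr scalerA.
Qed.

Lemma weylX_lattice l x : {subset l <= R} -> root_lattice x ->
  root_lattice (weylX l x).
Proof.
move=> + Lx; elim: l => //= a l IH /allP/andP[/= aR /allP lR].
by rewrite /root_refl -scaleNr; apply: root_lattice_add => //; apply: IH.
Qed.

Lemma weyl_word w : weyl D w ->
  exists2 l, {subset l <= R} & forall y, w y = weylY l y.
Proof.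
elim=> [|a w' aR _ [l lR wE]]; first by exists [::].
exists (a :: l) => [b|y]; last by rewrite /= wE.
by rewrite inE => /predU1P[->|/lR].
Qed.

Lemma word_weyl l : {subset l <= R} -> weyl D (weylY l).
Proof.
elim: l => [_|a l IH /allP/andP[/= aR /allP lR]]; first exact: weyl_id.
by apply: (weyl_reflection aR); apply: IH.
Qed.

Lemma weyl_comp w w' : weyl D w -> weyl D w' -> weyl D (w \o w').
Proof.
by move=> Ww Ww'; elim: Ww => // a u aR _; apply: (weyl_reflection aR).
Qed.

Lemma weyl_inverse w : weyl D w ->
  exists2 w', weyl D w' & forall y, w' (w y) = y.
Proof.
elim=> [|a u aR _ [u' Wu' uK]]; first by exists id => //; apply: weyl_id.
exists (u' \o (reflection D a \o id)).
  by apply: weyl_comp => //; apply: (weyl_reflection aR); apply: weyl_id.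
by move=> y /=; rewrite reflectionK.
Qed.

(* A translate of minimal norm lies in the Voronoi cell of [n] times the root
   lattice, which is cut out by these inequalities. *)
Lemma root_lattice_translate (n : nat) x : (0 < n)%N ->
  exists2 mu, root_lattice mu &
    {in R, forall a, pairing (x + n%:Z *: mu) a^v <= n%:Z}.
Proof.
move=> n0; have [m] := ubnP (absz (rform D x x)); elim: m x => // m IHm x lt_m.
have [[a [aR gt_n]]|no] := pselect (exists a, a \in R /\ n%:Z < pairing x a^v);
  last first.
  exists 0; first exact: root_lattice0.
  move=> a aR; rewrite scaler0 addr0 leNgt; apply/negP => ?.
  by apply: no; exists a.
have N0 := rform_gt0 aR.
have E : rform D (x + (- n%:Z) *: a) (x + (- n%:Z) *: a) =
    rform D x x + n%:Z * rform D a a * (n%:Z - pairing x a^v).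
  rewrite !(rformDl, rformDr, rformZl, rformZr) (rformC D a x).
  rewrite mulrBr -[_ * _ * pairing _ _]mulrA -rform_root //; ring.
have lt0 : n%:Z * rform D a a * (n%:Z - pairing x a^v) < 0.
  by rewrite pmulr_rlt0 ?subr_lt0 // mulr_gt0.
have ge0 := rform_ge0 D x.
have ge0' := rform_ge0 D (x + (- n%:Z) *: a).
have [|mu Lmu muP] := IHm (x + (- n%:Z) *: a); first by lia.
exists (mu + (-1) *: a); first exact: root_lattice_add.
move=> b bR; have := muP b bR.
by rewrite scalerDr scalerA mulrN1 addrAC addrA.
Qed.

End RootLattice.

(** * Moving into the alcove and fixing a vertex *)

Section Alcove.
Variables (r : nat) (D : root_datum r) (Delta : 'I_r -> 'rV[int]_r).
Variables (theta : 'rV[int]_r) (c : 'I_r -> nat).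
Local Notation R := (Defs.roots D).
Local Notation "a ^v" := (coroot D a) (at level 2, format "a ^v").
Hypothesis reducedR : reduced D.
Hypothesis simpleD : is_simple_roots D Delta.
Hypothesis thetaR : theta \in R.
Hypothesis theta_coroot : theta^v = \sum_i (Delta i)^v *+ c i.
Hypothesis theta_top : {in coroots D, forall z, exists d : 'I_r -> nat,
  theta^v - z = \sum_i (Delta i)^v *+ d i}.
Variable om : 'I_r -> 'rV[int]_r.
Hypothesis omD : forall i j, pairing (om i) (Delta j)^v = (i == j)%:R.
Hypothesis omE : forall y, y = \sum_i pairing (om i) y *: (Delta i)^v.
Let simpleR i : Delta i \in R := simple_root simpleD i.
Hint Resolve simpleR : core.
Local Notation simple_aroot := (simple_aroot Delta theta).
Local Notation in_alcove := (in_alcove D Delta theta).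
Local Notation wact := (wact D Delta theta).
Local Notation pos := (pos D om).

(** Induction on the number of positive roots whose coroots are negative on [x]: reflecting in a
    simple one removes it and permutes the other positive roots. *)
Lemma dominant_conj x : exists2 l, {subset l <= R} &
  forall i, 0 <= pairing (weylX D l x) (Delta i)^v.
Proof.
pose bad x a := (pairing x a^v < 0) && pos a.
have [m] := ubnP (size (filter (bad x) R)); elim: m x => // m IHm x lt_m.
have [[i lt0]|no] := pselect (exists i, pairing x (Delta i)^v < 0); last first.
  exists [::] => // i; rewrite leNgt; apply/negP => ?.
  by apply: no; exists i.
have [|l lR lP] := IHm (root_refl D (Delta i) x).
  rewrite ltnS in lt_m; apply: leq_trans lt_m.
  pose s := map (root_refl D (Delta i))
    (filter (bad (root_refl D (Delta i) x)) R).
  have sz : (size (Delta i :: s) <= size (filter (bad x) R))%N.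
    apply: uniq_leq_size => /=.
      apply/andP; split; last first.
        rewrite map_inj_uniq; last exact: (inv_inj (root_reflK (simpleR i))).
        exact/filter_uniq/roots_uniq.
      apply/negP => /mapP[b]; rewrite mem_filter => /andP[/andP[_ pb] bR] E.
      have [nR nv] := oppr_root (simpleR i).
      have bE : b = - Delta i.
        rewrite -(root_reflK (simpleR i) b) -E /root_refl pairing_coroot //.
        by rewrite scaler_nat mulr2n opprD addrA subrr sub0r.
      by move: pb; rewrite bE (pos_opp simpleD omD omE) // (pos_simple omD).
    move=> _ /predU1P[->|/mapP[b + ->]]; rewrite !mem_filter.
      by rewrite /bad lt0 simpleR (pos_simple omD).
    case/andP=> /andP[lt0' pb] bR; rewrite root_refl_root // andbT /bad.
    rewrite coroot_root_refl // -root_reflE lt0' /=.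
    apply: (pos_root_refl reducedR simpleD omD) => //.
    apply: contraTneq lt0' => ->;
      rewrite root_reflE /reflection pairing_coroot //.
    by rewrite scaler_nat mulr2n opprD addrA subrr sub0r pairingE -leNgt
      oppr_ge0 ltW.
  by rewrite /s /= size_map in sz.
exists (rcons l (Delta i)) => [b|j].
  by rewrite mem_rcons inE => /predU1P[->|/lR].
by rewrite /weylX foldr_rcons; apply: lP.
Qed.

(** The bounds of [root_lattice_translate] concern all roots, so they survive the passage to the
    dominant chamber; for [theta] they give the affine wall. *)
Lemma alcove_conj (n : nat) x : (0 < n)%N ->
  exists l mu, [/\ {subset l <= R}, root_lattice D mu &
    in_alcove (weylX D l (x + n%:Z *: mu), n%:Z)].
Proof.
move=> n0; have [mu Lmu muP] := root_lattice_translate D x n0.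
have [l lR lP] := dominant_conj (x + n%:Z *: mu).
exists l, mu; split => // -[i|]; rewrite /aval /=.
  by rewrite mul0r addr0.
have [nR nv] := oppr_root thetaR.
rewrite mul1r nv pairingE addrC subr_ge0.
suff top k t : {subset k <= R} -> t \in R ->
    pairing (weylX D k (x + n%:Z *: mu)) t^v <= n%:Z by apply: top.
elim: k t => [|a k IH] t kR tR /=; first exact: muP.
have aR : a \in R by rewrite kR // mem_head.
rewrite root_reflE -coroot_root_refl //; apply: IH; last exact: root_refl_root.
by move=> b bk; rewrite kR // inE bk orbT.
Qed.

Lemma weylX_wact l : {subset l <= R} ->
  exists l', forall v, wact l' v = (weylX D l v.1, v.2).
Proof.
elim: l => [_|a l IH /allP/andP[/= aR /allP lR]]; first by exists [::] => -[].
have [l1 l1E] := IH lR.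
have [l2 l2E] := aroot_word reducedR simpleD thetaR theta_coroot theta_top
  omD omE
  (s := (a, 0)) aR.
exists (l2 ++ l1) => v; rewrite wact_cat l2E l1E /arefl /aval /=.
by rewrite mul0r addr0.
Qed.

(** A translation along [a] is a product of two reflections in parallel walls. *)
Lemma translation_wact mu : root_lattice D mu ->
  exists l', forall v, wact l' v = (v.1 + v.2 *: mu, v.2).
Proof.
elim=> [|a k x aR _ [l1 l1E]].
  by exists [::] => -[u l] /=; rewrite scaler0 addr0.
have W := aroot_word reducedR simpleD thetaR theta_coroot theta_top omD omE.
have [l2 l2E] := W (a, 0) aR; have [l3 l3E] := W (a, - k) aR.
exists (l3 ++ l2 ++ l1) => v; rewrite !wact_cat l3E l2E l1E /arefl /aval /=.
congr (_, _); rewrite !pairingE pairing_coroot //.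
by apply/rowP => i; rewrite !mxE; ring.
Qed.

(* [n o / c0] is the vertex opposite to a wall not containing [x]. *)
Lemma alcove_fixed (n : nat) x : (0 < n)%N -> (forall i, coprime n (c i)) ->
    in_alcove (x, n%:Z) ->
  exists (c0 : nat) o, coprime n c0 /\
    forall l mu, {subset l <= R} -> root_lattice D mu ->
      weylX D l x + n%:Z *: mu = x ->
      weylX D l (c0%:Z *: x - n%:Z *: o) = c0%:Z *: x - n%:Z *: o.
Proof.
move=> n0 cop xA.
suff [c0 [o [cop0 oP]]] : exists (c0 : nat) o, coprime n c0 /\
    forall i, aval D (simple_aroot i) (x, n%:Z) = 0 ->
              aval D (simple_aroot i) (o, c0%:Z) = 0.
  exists c0, o; split => // l mu lR Lmu fixx.
  have [l1 l1E] := weylX_wact lR; have [l2 l2E] := translation_wact Lmu.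
  have actE v : wact (l2 ++ l1) v = (weylX D l v.1 + v.2 *: mu, v.2).
    by rewrite wact_cat l2E l1E.
  have := wact_fix reducedR simpleD thetaR theta_coroot theta_top omD omE
    (l := l2 ++ l1) xA _ oP.
  rewrite !actE /= fixx => /(_ isT erefl)[fixo].
  (* The combination has level zero, so the translation parts cancel. *)
  rewrite -scaleNr weylXD !weylXZ.
  have -> : weylX D l x = x - n%:Z *: mu by rewrite -{2}fixx addrK.
  have -> : weylX D l o = o - c0%:Z *: mu by rewrite -{2}fixo addrK.
  by apply/rowP => i; rewrite !mxE; ring.
have [nR nv] := oppr_root thetaR.
have [x0|x0] := eqVneq (aval D (simple_aroot None) (x, n%:Z)) 0; last first.
  (* The affine wall misses [x]; the opposite vertex is the origin. *)
  exists 1%N, 0; split; first exact: coprimen1.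
  move=> [i|] //; last by move=> E; rewrite E eqxx in x0.
  by rewrite /aval /= pairingE mul0r addr0.
have [[j xj]|no] := pselect (exists j, pairing x (Delta j)^v != 0); last first.
  (* A point on every finite wall is the origin, which is off the affine wall since [n > 0]. *)
  move: x0; rewrite /aval /= nv pairingE (pairing_coef omE) big1 => [|i _].
    by rewrite oppr0 add0r mul1r => -[E]; rewrite E in n0.
  have [->|ne0] := eqVneq (pairing x (Delta i)^v) 0; first by rewrite mulr0.
  by case: no; exists i.
exists (c j), (om j); split => // -[i|] /=; rewrite /aval /=.
  rewrite !mul0r !addr0 omD; case: eqP => // <- E.
  by rewrite E eqxx in xj.
by move=> _; rewrite nv pairingE (coef_theta theta_coroot omD) mul1r addNr.
Qed.

End Alcove.

(** * From cocharacters to weights through the quadratic form *)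

Section InvariantForm.
Variables (r : nat) (D : root_datum r) (Q : quadratic_form r).
Local Notation R := (Defs.roots D).
Local Notation "a ^v" := (coroot D a) (at level 2, format "a ^v").
Hypothesis QW : weyl_invariant D Q.
Implicit Types y z : 'rV[int]_r.

Lemma polarC y z : polar Q y z = polar Q z y.
Proof. by rewrite /polar (addrC y) addrAC. Qed.

Lemma polar0 z : polar Q 0 z = 0.
Proof. by apply: (addIr (polar Q 0 z)); rewrite -polarDl addr0 add0r. Qed.

Lemma polarZl k y z : polar Q (k *: y) z = k * polar Q y z.
Proof.
elim/int_rect: k => [|m IH|m IH].
- by rewrite scale0r mul0r polar0.
- by rewrite intS scalerDl polarDl IH scale1r; ring.
apply: (addIr (polar Q y z)).
rewrite -[X in polar _ _ _ + polar _ X _]scale1r -polarDl -scalerDl.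
have -> : (- m.+1%:Z + 1 = - m%:Z) by lia.
by rewrite IH; lia.
Qed.

Definition weight_of y : 'rV[int]_r := y *m gram Q.

Lemma weight_ofP y z : pairing (weight_of y) z = polar Q y z.
Proof.
have sumE (f : 'rV[int]_r -> int) u : f 0 = 0 ->
    (forall x y, f (x + y) = f x + f y) -> (forall k x, f (k *: x) = k * f x) ->
    f u = \sum_i u 0 i * f (delta_mx 0 i).
  move=> f0 fD fZ; rewrite {1}[u]row_sum_delta (big_morph f fD f0).
  by apply: eq_bigr.
have polar_l (v u : 'rV[int]_r) :
  polar Q u v = \sum_i u 0 i * polar Q (delta_mx 0 i) v.
  by apply: (sumE (polar Q ^~ v)) => *; rewrite (polar0, polarDl, polarZl).
rewrite polarC polar_l; apply: eq_bigr => j _.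
rewrite mulrC polarC polar_l !mxE; congr (_ * _).
by apply: eq_bigr => i _; rewrite mxE.
Qed.

Lemma polar_reflection a y z : a \in R ->
  polar Q (reflection D a y) z = polar Q y (reflection D a z).
Proof.
move=> aR; have W := weyl_reflection aR (weyl_id D).
rewrite -{1}(reflectionK aR z) /polar -(weylD W) /=.
by have /= E := QW W; rewrite !E.
Qed.

Lemma weight_of_reflection a y : a \in R ->
  weight_of (reflection D a y) = root_refl D a (weight_of y).
Proof.
move=> aR; apply: pairing_injl => z.
by rewrite root_reflE !weight_ofP polar_reflection.
Qed.

Lemma weight_of_weyl l y : {subset l <= R} ->
  weight_of (weylY D l y) = weylX D l (weight_of y).
Proof.
elim: l => //= a l IH /allP/andP[/= aR /allP lR].
by rewrite weight_of_reflection // IH.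
Qed.

Lemma weight_ofD y z : weight_of (y + z) = weight_of y + weight_of z.
Proof. exact: mulmxDl. Qed.

Lemma weight_ofZ k y : weight_of (k *: y) = k *: weight_of y.
Proof. by rewrite /weight_of scalemxAl. Qed.

(** Equivariance under the reflection in [a], which negates the coroot, gives twice this
    identity. *)
Lemma weight_of_coroot a : a \in R -> weight_of a^v = Q a^v *: a.
Proof.
move=> aR; have := weight_of_reflection a^v aR.
rewrite /root_refl weight_ofP.
have -> : polar Q a^v a^v = 2 * Q a^v.
  rewrite /polar -mulr2n -scaler_nat qformZ; ring.
have -> : reflection D a a^v = (-1) *: a^v.
  rewrite /reflection pairing_coroot // scaler_nat mulr2n scaleN1r.
  by rewrite opprD addrA subrr sub0r.
rewrite weight_ofZ => /rowP E; apply/rowP => i.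
by have := E i; rewrite !mxE; lia.
Qed.

Lemma weight_of_lattice y : simply_connected D -> root_lattice D (weight_of y).
Proof.
move=> /(_ y)[f ->]; rewrite big_seq; elim/big_ind: _ => [|u v Lu Lv|a aR].
- by rewrite /weight_of mul0mx; apply: root_lattice0.
- by rewrite weight_ofD; apply: root_latticeD.
by rewrite weight_ofZ weight_of_coroot // scalerA; apply: root_latticeZ.
Qed.

Lemma weight_of_inj y z : \det (gram Q) != 0 ->
  weight_of y = weight_of z -> y = z.
Proof.
move=> d0 /(congr1 (mulmx^~ (\adj (gram Q)))); rewrite /weight_of.
rewrite -!mulmxA mul_mx_adj !mul_mx_scalar => /rowP E; apply/rowP => i.
by apply: (mulfI d0); have := E i; rewrite !mxE.
Qed.

Lemma weight_of_YQn (n : nat) y x : weight_of y = n%:Z *: x -> y \in YQn Q n.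
Proof.
by move=> E; apply/YQnP => z; rewrite -weight_ofP E pairingE dvdz_mulr.
Qed.

(** Multiplying the weight of [y] by the adjugate of the Gram matrix gives [y] times the
    determinant, which is prime to [n]. *)
Lemma YQn_divisible (n : nat) y : coprimez n%:Z (\det (gram Q)) ->
  y \in YQn Q n -> exists z, y = n%:Z *: z.
Proof.
move=> cop /YQnP yP.
have yn i : (n%:Z %| y 0%R i)%Z.
  rewrite -(Gauss_dvdzr _ cop).
  have -> : \det (gram Q) * y 0 i = (weight_of y *m \adj (gram Q)) 0 i.
    by rewrite /weight_of -mulmxA mul_mx_adj mul_mx_scalar mxE.
  rewrite mxE; apply: rpred_sum => j _; apply: dvdz_mulr.
  by rewrite -pairing_delta weight_ofP.
exists (\row_i (y 0%R i %/ n%:Z)%Z); apply/rowP => i; rewrite !mxE.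
by rewrite mulrC divzK.
Qed.

End InvariantForm.

(** * Stabiliser-fixed lifts and the splitting *)

Section Splitting.
Variables (r : nat) (D : root_datum r) (Delta : 'I_r -> 'rV[int]_r).
Variables (Q : quadratic_form r) (n : nat).
Hypothesis reducedR : reduced D.
Hypothesis sc : simply_connected D.
Hypothesis simpleD : is_simple_roots D Delta.
Hypothesis QW : weyl_invariant D Q.
Hypothesis n_gt0 : (0 < n)%N.
Local Notation cl := (\pi_(XQn Q n)).

Lemma fixed_lift y0 : oasitic D Delta Q n ->
  exists w y z, [/\ weyl D w, y = w y0, z - y \in YQn Q n &
    forall w', weyl D w' -> w' y - y \in YQn Q n -> w' z = z].
Proof.
case=> -[c [[/mapP[theta thetaR /esym th] top] cop]] copd.
have theta_top : {in coroots D, forall z, exists d : 'I_r -> nat,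
    coroot D theta - z = \sum_i coroot D (Delta i) *+ d i}.
  by move=> z zR; rewrite th; apply: top.
have [om [omD omE]] := dual_basis th theta_top sc.
have [d0|d0] := eqVneq (\det (gram Q)) 0.
  (* A zero determinant prime to [n] leaves only [n = 1]; the quotient is then trivial and 0 is a
     fixed lift. *)
  have n1 : n = 1%N by move: copd; rewrite d0 /coprimez gcdz0 => /eqP[].
  exists id, y0, 0; split => //; first exact: weyl_id.
    by apply/YQnP => z; rewrite n1 dvd1z.
  by move=> w' /weyl_word[l _ wE] _; rewrite wE; have := weylYZ D l 0 0;
    rewrite !scale0r.
have [l [mu [lR Lmu xA]]] :=
  alcove_conj reducedR simpleD thetaR omD omE (weight_of Q y0) n_gt0.
set x := weylX D l _ in xA.
have [c0 [o [cop0 oP]]] :=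
  alcove_fixed reducedR simpleD thetaR th theta_top omD omE n_gt0 cop xA.
set f := _ - _ in oP.
pose y := weylY D l y0; set d := \det (gram Q) in copd d0.
have xE : x = weight_of Q y + n%:Z *: weylX D l mu.
  by rewrite weight_of_weyl // -weylXZ -weylXD.
have Lmu' := weylX_lattice lR Lmu.
(* [e] inverts [d c0] modulo [n]. The adjugate lifts [d f] to [Y], so [z] has weight [e d f],
   congruent to [x] modulo [n]. *)
have [[u e] /= ue] :
    exists uv : int * int, uv.1 * n%:Z + uv.2 * (d * c0%:Z) = 1.
  by apply/coprimezP; rewrite coprimezMr copd.
pose z := e *: (f *m \adj (gram Q)).
have zE : weight_of Q z = (e * d) *: f.
  rewrite weight_ofZ /weight_of -mulmxA mul_adj_mx mul_mx_scalar scalerA.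
  by [].
exists (weylY D l), y, z; split => //; first exact: word_weyl.
  apply: (@weight_of_YQn _ _ _ _ ((e * d * c0%:Z) *: weylX D l mu
    - (e * d) *: o - u *: weight_of Q y)).
  rewrite -[- y]scaleN1r weight_ofD zE weight_ofZ /f xE.
  apply/rowP => i; rewrite !mxE.
  rewrite -[-1]opprK opprK -ue; ring.
move=> w' /weyl_word[l' l'R w'E]; rewrite !w'E => /(YQn_divisible copd)[v vE].
apply: (weight_of_inj d0); rewrite weight_of_weyl // zE weylXZ; congr (_ *: _).
(* With [w' y = y + n v], this translation brings the image of [x] back to [x]; simple connectedness
   puts the weight of [v] in the root lattice. *)
pose nu := weylX D l mu - weylX D l' (weylX D l mu) - weight_of Q v.
apply: (oP l' nu) => //.
  apply: root_latticeD; last by apply/root_latticeN/weight_of_lattice.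
  by apply: root_latticeD => //; apply/root_latticeN/weylX_lattice.
have E : weylX D l' (weight_of Q y) = weight_of Q y + n%:Z *: weight_of Q v.
  by rewrite -weight_of_weyl // -weight_ofZ -vE -weight_ofD addrC subrK.
rewrite xE weylXD weylXZ E /nu.
by apply/rowP => i; rewrite !mxE; ring.
Qed.

Lemma pi_eq y z : (cl y = cl z) <-> (y - z \in YQn Q n).
Proof. by rewrite Quotient.idealrBE; split=> [->|/eqP]. Qed.

(** The section sends the class of [w y] to [w z]; this is consistent because the stabiliser of the
    class of [y] fixes [z]. *)
Lemma orbit_splitting O : oasitic D Delta Q n -> weyl_orbit D O ->
  @splitting r Q n D O.
Proof.
move=> oas [q OE]; have [w0 [y [z [Ww0 yE zy fixz]]]] :=
  fixed_lift (repr q) oas.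
have {}yE : cl y = act w0 q by rewrite yE.
have zyE : cl z = cl y by apply/pi_eq.
have [w0' Ww0' w0K] := weyl_inverse Ww0.
have actM w w' p : weyl D w -> weyl D w' ->
    act (w \o w') p = act w (act w' p) :> XQn Q n.
  by move=> Ww Ww'; rewrite [act w' p]/act (actE _ _ QW Ww).
have ex (t : {p : XQn Q n | O p}) : exists w, weyl D w /\ sval t = cl (w y).
  case: t => p /=; rewrite OE => -[w Ww <-].
  exists (w \o w0'); split; first exact: weyl_comp.
  have Wc : weyl D (w \o w0') by apply: weyl_comp.
  rewrite -(actE _ y QW Wc) yE -actM //.
  by rewrite /act /= w0K.
have [wt wtP] := choice ex.
exists (fun t => wt t z); split => [t|w Ww t t' E].
  have [Wt ->] := wtP t.
  by rewrite -!(actE _ _ QW Wt) zyE.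
have [Wt tE] := wtP t; have [Wt' tE'] := wtP t'.
have [wi Wwi wiK] := weyl_inverse Wt'.
(* This composite stabilises the class of [y], hence fixes [z], which is the required
   equivariance. *)
have Wc : weyl D (wi \o (w \o wt t)) by do 2!apply: weyl_comp => //.
have [wj _ wjK] := weyl_inverse Wwi.
apply: (can_inj wjK); rewrite wiK.
apply/esym; apply: (fixz _ Wc); apply/pi_eq => /=.
rewrite -(actE _ _ QW Wwi) -(actE _ _ QW Ww) -tE -E tE' (actE _ _ QW Wwi).
by rewrite wiK.
Qed.

End Splitting.

Theorem corollary6p4 (r : nat) (D : root_datum r) (Delta : 'I_r -> 'rV[int]_r)
    (Q : quadratic_form r) (n : nat)
    (hred : reduced D) (hirr : irreducible D) (hsc : simply_connected D)
    (hDelta : is_simple_roots D Delta)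
    (hQW : weyl_invariant D Q)
    (hQ1 : forall y, short_coroot D y -> Q y = 1)
    (hn : (0 < n)%N)
    (hoas : oasitic D Delta Q n)
    (O : set (XQn Q n)) (hO : weyl_orbit D O) :
  splitting D O.
Proof. exact: (orbit_splitting hred hsc hDelta hQW hn hoas hO). Qed.
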